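(* Let $(\mathcal C,\mathsf d_{\mathcal C})$ be the cone over a geodesic metric space $(\mathcal X,\mathsf d_{\mathcal X})$. Let $z_0=[x_0,r_0]$, $z_1=[x_1,r_1]\in\mathcal C$ and $\widetilde r_0,\widetilde r_1\ge0$. If $\boldsymbol z_{01}\in\mathrm{Geod}(z_0,z_1)$, then $\widetilde{\boldsymbol z}_{01}(t)=A_{01}(t)\,\boldsymbol z_{01}(B_{01}(t))$, $t\in[0,1]$, with $$A_{01}(t)=\widetilde r_0+(\widetilde r_1-\widetilde r_0)t\qquad\text{and}\qquad B_{01}(t)=\frac{\widetilde r_1t}{A_{01}(t)},$$ is an element of $\mathrm{Geod}(\widetilde r_0z_0,\widetilde r_1z_1)$.
   Context: The cone $\mathcal C$ over $(\mathcal X,\mathsf d_{\mathcal X})$ is the quotient of $\mathcal X\times[0,\infty)$ obtained by identifying all points of $\mathcal X\times\{0\}$ with one point $\boldsymbol 0$ (the apex); the class of $(x,r)$ is written $[x,r]$, and $\mathsf d_{\mathcal C}^2([x_0,r_0],[x_1,r_1])=r_0^2+r_1^2-2r_0r_1\cos(\min\{\pi,\mathsf d_{\mathcal X}(x_0,x_1)\})$. For $z=[x,r]\in\mathcal C$ and $\widetilde r\ge0$, $\widetilde r z:=[x,\widetilde r r]$; if $A_{01}(t)=0$ then $A_{01}(t)\boldsymbol z_{01}(B_{01}(t))$ is understood as the apex. For points $y_0,y_1$ of a metric space $(Y,\mathsf d)$, $\mathrm{Geod}(y_0,y_1)$ is the set of constant-speed geodesics $\boldsymbol y:[0,1]\to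 Y$ with $\boldsymbol y(0)=y_0$, $\boldsymbol y(1)=y_1$ and $\mathsf d(\boldsymbol y(s),\boldsymbol y(t))=|t-s|\,\mathsf d(y_0,y_1)$ (constant curves are allowed if $y_0=y_1$). *)

(* Defs.v *)
From HB Require Import structures.
From mathcomp Require Import all_boot all_order all_algebra.
From mathcomp Require Import all_classical all_reals all_analysis.
From mathcomp Require Import ring lra.

Set Implicit Arguments.
Unset Strict Implicit.
Unset Printing Implicit Defensive.

Import Order.TTheory GRing.Theory Num.Theory.

Local Open Scope classical_set_scope.
Local Open Scope ring_scope.

(* Curves are parametrized by the type [{i01 R}] of the reals in [0, 1]. *)
Definition Geod (R : realType) (Y : metricType R) (y0 y1 : Y) :
    set ({i01 R} -> Y) :=
  [set y | [/\ y 0%:i01 = y0, y 1%:i01 = y1 &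
     forall s t : {i01 R},
       mdist (y s) (y t) = `|t%:num - s%:num| * mdist y0 y1]].

Definition geodesic_space (R : realType) (Y : metricType R) : Prop :=
  forall y0 y1 : Y, exists y, Geod y0 y1 y.

Section cone_type.
Variables (R : realType) (X : metricType R).

Definition cone_eq (p q : X * {nonneg R}) : bool :=
  (p == q) || (p.2%:num == 0) && (q.2%:num == 0).

Lemma cone_eq_refl : reflexive cone_eq.
Proof. by move=> p; rewrite /cone_eq eqxx. Qed.

Lemma cone_eq_sym : symmetric cone_eq.
Proof. by move=> p q; rewrite /cone_eq eq_sym andbC. Qed.

Lemma cone_eq_trans : transitive cone_eq.
Proof.
move=> q p s /orP[/eqP -> //|/andP[p0 q0]] /orP[/eqP <-|/andP[_ s0]].
  by rewrite /cone_eq p0 q0 orbT.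
by rewrite /cone_eq p0 s0 orbT.
Qed.

Canonical cone_equiv : equiv_rel _ :=
  EquivRel cone_eq cone_eq_refl cone_eq_sym cone_eq_trans.

Definition cone := {eq_quot cone_equiv}%qT.

(* [cone_point x r] is the class [x, r]; the apex is [x, 0] for any [x]. *)
Definition cone_point (x : X) (r : {nonneg R}) : cone := (\pi_cone (x, r))%qT.

Definition cone_dist_repr (p q : X * {nonneg R}) : R :=
  Num.sqrt (p.2%:num ^+ 2 + q.2%:num ^+ 2
    - 2 * p.2%:num * q.2%:num * cos (Num.min pi (mdist p.1 q.1))).

Definition cone_dist (z w : cone) : R :=
  cone_dist_repr (repr z)%qT (repr w)%qT.

Definition cone_scale (a : {nonneg R}) (z : cone) : cone :=
  let p := (repr z)%qT in cone_point p.1 (a%:num * p.2%:num)%:nng.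

Lemma cone_ind (P : cone -> Prop) :
  (forall x r, P (cone_point x r)) -> forall z, P z.
Proof. by move=> h z; rewrite -(reprK z)%qT; case: (repr z)%qT => x r; apply: h. Qed.

Lemma cone_pointP x r y s :
  reflect ((x, r) = (y, s) \/ r%:num = 0 /\ s%:num = 0)
          (cone_point x r == cone_point y s).
Proof.
rewrite /cone_point eqmodE /= /cone_eq /=.
apply: (iffP orP) => -[].
- by move/eqP; left.
- by case/andP => /eqP ? /eqP ?; right.
- by move/eqP; left.
- by case=> -> ->; right; rewrite eqxx.
Qed.

Lemma repr_cone_point x r : cone_eq (repr (cone_point x r))%qT (x, r).
Proof.
have := eqmodE cone_equiv (repr (cone_point x r))%qT (x, r).
by rewrite reprK eqxx => <-.
Qed.

Lemma cone_dist_repr_sym p q : cone_dist_repr p q = cone_dist_repr q p.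
Proof. by rewrite /cone_dist_repr metric_sym; congr Num.sqrt; ring. Qed.

Lemma cone_dist_repr_eq p p' q :
  cone_eq p p' -> cone_dist_repr p q = cone_dist_repr p' q.
Proof.
case/orP => [/eqP -> //|/andP[/eqP p0 /eqP p'0]].
by rewrite /cone_dist_repr p0 p'0; congr Num.sqrt; ring.
Qed.

Lemma cone_distE x r y s : cone_dist (cone_point x r) (cone_point y s) =
  Num.sqrt (r%:num ^+ 2 + s%:num ^+ 2
    - 2 * r%:num * s%:num * cos (Num.min pi (mdist x y))).
Proof.
rewrite /cone_dist (cone_dist_repr_eq _ (repr_cone_point x r)).
by rewrite cone_dist_repr_sym (cone_dist_repr_eq _ (repr_cone_point y s))
  cone_dist_repr_sym.
Qed.

Lemma cone_scaleE a x r :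
  cone_scale a (cone_point x r) = cone_point x (a%:num * r%:num)%:nng.
Proof.
rewrite /cone_scale; case/orP: (repr_cone_point x r) => [/eqP -> //|].
case/andP => /eqP /= p0 /eqP /= q0; apply/eqP/cone_pointP; right => /=.
by rewrite p0 q0 mulr0.
Qed.

Lemma cone_scale0 a z x : a%:num = 0 -> cone_scale a z = cone_point x 0%:nng.
Proof.
by move=> a0; apply/eqP/cone_pointP; right => /=; rewrite a0 mul0r.
Qed.

Let mdistpi (x y : X) : 0 <= Num.min pi (mdist x y) <= pi.
Proof. by rewrite le_min mdist_ge0 pi_ge0 ge_min lexx. Qed.

Lemma cone_radicandE (r s c : R) :
  r ^+ 2 + s ^+ 2 - 2 * r * s * c = (r - s) ^+ 2 + 2 * r * s * (1 - c).
Proof. by ring. Qed.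

Lemma cone_radicand_ge0 (r s c : R) : 0 <= r -> 0 <= s -> c <= 1 ->
  0 <= r ^+ 2 + s ^+ 2 - 2 * r * s * c.
Proof.
move=> r0 s0 c1; rewrite cone_radicandE addr_ge0 ?sqr_ge0//.
by rewrite !mulr_ge0// subr_ge0.
Qed.

Lemma cone_distxx z : cone_dist z z = 0.
Proof.
elim/cone_ind: z => x r; rewrite cone_distE mdistxx (min_idPr (pi_ge0 R)) cos0.
by rewrite -[RHS]sqrtr0; congr Num.sqrt; ring.
Qed.

Lemma cone_dist_sym z w : cone_dist z w = cone_dist w z.
Proof. exact: cone_dist_repr_sym. Qed.

Lemma cone_dist_eq0 z w : cone_dist z w = 0 -> z = w.
Proof.
elim/cone_ind: z => x r; elim/cone_ind: w => y s; rewrite cone_distE => /eqP.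
set c := cos _; have c1 : c <= 1 by exact: cos_le1.
rewrite sqrtr_eq0 cone_radicandE => h.
have h2 : 0 <= 2 * r%:num * s%:num * (1 - c).
  by rewrite !mulr_ge0// subr_ge0.
have := sqr_ge0 (r%:num - s%:num) => h1.
have /eqP : (r%:num - s%:num) ^+ 2 = 0 by lra.
rewrite sqrf_eq0 subr_eq0 => /eqP/val_inj rs; subst s.
have /eqP : 2 * r%:num * r%:num * (1 - c) = 0 by lra.
rewrite !mulf_eq0 pnatr_eq0/= orbb.
move=> rc; apply/eqP/cone_pointP.
have [r0|r0] := eqVneq r%:num 0; first by right.
move: rc; rewrite (negbTE r0)/= subr_eq0 => /eqP c1'; left.
have : Num.min pi (mdist x y) = 0.
  apply: cos_inj; last by rewrite cos0.
    by rewrite in_itv/=; exact: mdistpi.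
  by rewrite in_itv/= lexx pi_ge0.
rewrite minEle; case: ifP => _; first by move=> p0; have := pi_gt0 R; rewrite p0 ltxx.
by move/mdist_positivity => ->.
Qed.

Lemma norm2_triangle (a b c d : R) :
  Num.sqrt ((a + c) ^+ 2 + (b + d) ^+ 2) <=
  Num.sqrt (a ^+ 2 + b ^+ 2) + Num.sqrt (c ^+ 2 + d ^+ 2).
Proof.
have u0 : 0 <= a ^+ 2 + b ^+ 2 by rewrite addr_ge0 ?sqr_ge0.
have v0 : 0 <= c ^+ 2 + d ^+ 2 by rewrite addr_ge0 ?sqr_ge0.
rewrite -ler_sqr ?nnegrE ?addr_ge0 ?sqrtr_ge0// [leRHS]sqrrD
  !sqr_sqrtr ?addr_ge0 ?sqr_ge0//.
suff : a * c + b * d <=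
    Num.sqrt (a ^+ 2 + b ^+ 2) * Num.sqrt (c ^+ 2 + d ^+ 2) by lra.
rewrite -sqrtrM// (le_trans (ler_norm _))// -sqrtr_sqr ler_wsqrtr//.
by rewrite -subr_ge0 (_ : _ - _ = (a * d - b * c) ^+ 2) ?sqr_ge0//; ring.
Qed.

Lemma le_cone_radicand_sqrt (r s c : R) : c <= 1 -> -1 <= c ->
  r - s * c <= Num.sqrt (r ^+ 2 + s ^+ 2 - 2 * r * s * c).
Proof.
move=> c1 cN1; rewrite (le_trans (ler_norm _))// -sqrtr_sqr ler_wsqrtr//.
rewrite -subr_ge0 (_ : _ - _ = s ^+ 2 * ((1 - c) * (1 + c))); last by ring.
by rewrite mulr_ge0 ?sqr_ge0// mulr_ge0 ?subr_ge0// -lerBlDl sub0r.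
Qed.

Lemma cone_dist_triangle w z v :
  cone_dist z v <= cone_dist z w + cone_dist w v.
Proof.
elim/cone_ind: z => x r; elim/cone_ind: w => y s; elim/cone_ind: v => u t.
rewrite !cone_distE.
set a := Num.min _ (mdist x y); set b := Num.min _ (mdist y u).
set c := Num.min _ (mdist x u).
have r0 : 0 <= r%:num by []. have s0 : 0 <= s%:num by [].
have t0 : 0 <= t%:num by [].
have /andP[a0 api] : 0 <= a <= pi := mdistpi x y.
have /andP[b0 bpi] : 0 <= b <= pi := mdistpi y u.
have /andP[c0 cpi] : 0 <= c <= pi := mdistpi x u.
have [ab|ab] := leP (a + b) pi.
  have cab : c <= a + b.
    rewrite /a /b /c; have := metric_triangle x y u.
    have := mdist_ge0 x y; have := mdist_ge0 y u; have := pi_ge0 R.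
    by rewrite !minEle; do !case: ifP => /=; lra.
  have cosab : cos (a + b) <= cos c.
    by rewrite leNgt ltr_cos ?in_itv/= ?c0 ?cpi ?addr_ge0//= -leNgt.
  pose A := r%:num * cos a - s%:num; pose B := r%:num * sin a.
  pose C := s%:num - t%:num * cos b; pose D := t%:num * sin b.
  have := norm2_triangle A B C D.
  have -> : A ^+ 2 + B ^+ 2 =
      r%:num ^+ 2 + s%:num ^+ 2 - 2 * r%:num * s%:num * cos a.
    by rewrite /A /B !exprMn sin2cos2; ring.
  have -> : C ^+ 2 + D ^+ 2 =
      s%:num ^+ 2 + t%:num ^+ 2 - 2 * s%:num * t%:num * cos b.
    by rewrite /C /D !exprMn sin2cos2; ring.
  have -> : (A + C) ^+ 2 + (B + D) ^+ 2 =
      r%:num ^+ 2 + t%:num ^+ 2 - 2 * r%:num * t%:num * cos (a + b).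
    have sa := sin2cos2 a; have sb := sin2cos2 b.
    rewrite cosD.
    transitivity (r%:num ^+ 2 * (cos a ^+ 2 + sin a ^+ 2)
      + t%:num ^+ 2 * (cos b ^+ 2 + sin b ^+ 2)
      - 2 * r%:num * t%:num * (cos a * cos b - sin a * sin b)).
      by rewrite /A /B /C /D; ring.
    by rewrite !cos2Dsin2; ring.
  apply: le_trans; apply: ler_wsqrtr; rewrite lerD2l lerN2.
  by rewrite ler_wpM2l// !mulr_ge0.
have cosb : cos b <= - cos a.
  have -> : - cos a = cos (- a + pi) by rewrite cosDpi cosN.
  rewrite leNgt ltr_cos ?in_itv/= ?b0 ?bpi// -?leNgt; first by lra.
  by apply/andP; split; lra.
have ha := @le_cone_radicand_sqrt r%:num s%:num _ (cos_le1 a) (cos_geN1 a).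
have hb := @le_cone_radicand_sqrt t%:num s%:num _ (cos_le1 b) (cos_geN1 b).
have hc : Num.sqrt (r%:num ^+ 2 + t%:num ^+ 2 - 2 * r%:num * t%:num * cos c)
    <= r%:num + t%:num.
  rewrite -[leRHS]ger0_norm ?addr_ge0// -sqrtr_sqr ler_wsqrtr//.
  have : 0 <= 2 * r%:num * t%:num * (1 + cos c).
    by rewrite !mulr_ge0// -lerBlDl sub0r cos_geN1.
  lra.
have hb' : t%:num - s%:num * cos b <=
    Num.sqrt (s%:num ^+ 2 + t%:num ^+ 2 - 2 * s%:num * t%:num * cos b).
  by apply: (le_trans hb); rewrite le_eqVlt; apply/orP; left; apply/eqP;
     congr Num.sqrt; ring.
apply: (le_trans hc); apply: le_trans (lerD ha hb').
have : 0 <= s%:num * (- cos a - cos b) by rewrite mulr_ge0// subr_ge0.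
lra.
Qed.

HB.instance Definition _ := Choice.on cone.
HB.instance Definition _ := isMetric.Build R cone
  cone_distxx cone_dist_eq0 cone_dist_sym cone_dist_triangle.

Lemma cone_mdistE x r y s :
  mdist (cone_point x r : cone) (cone_point y s) =
  Num.sqrt (r%:num ^+ 2 + s%:num ^+ 2
    - 2 * r%:num * s%:num * cos (Num.min pi (mdist x y))).
Proof. exact: cone_distE. Qed.

End cone_type.

Section reparametrization.
Variables (R : realType) (r0 r1 : {nonneg R}) (t : {i01 R}).

Lemma A01_ge0 : 0 <= r0%:num + (r1%:num - r0%:num) * t%:num.
Proof.
rewrite (_ : _ + _ = (1 - t%:num) * r0%:num + t%:num * r1%:num); last by ring.
by rewrite addr_ge0// mulr_ge0// subr_ge0.
Qed.

Definition A01 : {nonneg R} := NngNum A01_ge0.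

Lemma B01_ge0 : 0 <= r1%:num * t%:num / A01%:num.
Proof. by rewrite divr_ge0. Qed.

Lemma B01_le1 : r1%:num * t%:num / A01%:num <= 1.
Proof.
have [A0|A0] := eqVneq A01%:num 0; first by rewrite A0 invr0 mulr0 ler01.
have Agt0 : 0 < A01%:num by rewrite lt_neqAle eq_sym A0 A01_ge0.
rewrite ler_pdivrMr// mul1r /=.
have : 0 <= (1 - t%:num) * r0%:num by rewrite mulr_ge0// subr_ge0.
lra.
Qed.

(* Since x / 0 = 0, [B01] is 0 where [A01] vanishes; its value there is
   irrelevant by [cone_scale0]. *)
Definition B01 : {i01 R} := Itv01 B01_ge0 B01_le1.

End reparametrization.

(* Main.v *)
Require Import Defs.
From mathcomp Require Import all_boot all_order all_algebra.
From mathcomp Require Import all_classical all_reals all_analysis.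
From mathcomp Require Import ring lra.

(* Expanding the cone metric gives, for all scalars a, b >= 0,
     d(a z, b w)^2 = a b d(z, w)^2 + (a - b) (a |z|^2 - b |w|^2),
   where |z| is the distance of z to the apex.  Along a geodesic from z0 to z1
   of length D the squared radius is, as in the Euclidean plane,
     |z(t)|^2 = (1 - t) |z0|^2 + t |z1|^2 - t (1 - t) D^2.
   Inserting the second identity into the first, the claim becomes a polynomial
   identity modulo A B = rt1 t and A (1 - B) = rt0 (1 - t). *)

Import Order.TTheory GRing.Theory Num.Theory.

Local Open Scope ring_scope.

Section cone.
Context {R : realType} {X : metricType R}.

(** The choice of representative is harmless: only the apex has several, and all of them have radius
    0. *)
Definition cone_radius (z : cone X) : R := (repr z)%qT.2%:num.

Lemma cone_radiusE (x : X) (r : {nonneg R}) :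
  cone_radius (cone_point x r) = r%:num.
Proof.
rewrite /cone_radius; case/orP: (repr_cone_point x r) => [/eqP -> //|].
by case/andP => /eqP -> /eqP ->.
Qed.

Lemma sqr_mdist_cone (x y : X) (r s : {nonneg R}) :
  mdist (cone_point x r) (cone_point y s) ^+ 2 =
  r%:num ^+ 2 + s%:num ^+ 2
    - 2 * r%:num * s%:num * cos (Num.min pi (mdist x y)).
Proof. by rewrite cone_mdistE sqr_sqrtr// cone_radicand_ge0// cos_le1. Qed.

Lemma sqr_mdist_cone_scale (a b : {nonneg R}) (z w : cone X) :
  mdist (cone_scale a z) (cone_scale b w) ^+ 2 =
  a%:num * b%:num * mdist z w ^+ 2
  + (a%:num - b%:num)
    * (a%:num * cone_radius z ^+ 2 - b%:num * cone_radius w ^+ 2).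
Proof.
elim/cone_ind: z => x r; elim/cone_ind: w => y s.
by rewrite !cone_scaleE !sqr_mdist_cone !cone_radiusE /=; ring.
Qed.

Lemma min_pi_mdist_itv (x y : X) : 0 <= Num.min pi (mdist x y) <= pi.
Proof. by rewrite le_min mdist_ge0 pi_ge0 ge_min lexx. Qed.

(* Law of cosines for the points of polar coordinates (p, 0), (s, a),
   (q, a + b) in the plane: the point (s, a) splits the segment in ratio t. *)
Lemma planar_radius (p q s t D a b : R) : 0 <= t <= 1 ->
  p ^+ 2 + s ^+ 2 - 2 * p * s * cos a = t ^+ 2 * D ^+ 2 ->
  q ^+ 2 + s ^+ 2 - 2 * q * s * cos b = (1 - t) ^+ 2 * D ^+ 2 ->
  D ^+ 2 <= p ^+ 2 + q ^+ 2 - 2 * p * q * cos (a + b) ->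
  s ^+ 2 = (1 - t) * p ^+ 2 + t * q ^+ 2 - t * (1 - t) * D ^+ 2.
Proof.
move=> /andP[t0 t1] ha hb; set E := (leRHS) => hD.
have sa := cos2Dsin2 a; have sb := cos2Dsin2 b.
(* With P, S, Q the three points, [(u, - v)] is [(1 - t) P + t Q - S] in the frame whose first axis
   has direction [a]. Its squared norm is [t (1 - t) (D ^+ 2 - E)], which is at most 0. *)
pose u := (1 - t) * p * cos a + t * q * cos b - s.
pose v := (1 - t) * p * sin a - t * q * sin b.
have uvE : u ^+ 2 + v ^+ 2 = t * (1 - t) * (D ^+ 2 - E).
  transitivity ((1 - t) ^+ 2 * p ^+ 2 * (cos a ^+ 2 + sin a ^+ 2)
    + t ^+ 2 * q ^+ 2 * (cos b ^+ 2 + sin b ^+ 2) + s ^+ 2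
    + 2 * t * (1 - t) * p * q * (cos a * cos b - sin a * sin b)
    - 2 * (1 - t) * p * s * cos a - 2 * t * q * s * cos b).
    by rewrite /u /v; ring.
  rewrite sa sb -cosD; rewrite /E; set c := cos (a + b).
  transitivity ((1 - t) * (p ^+ 2 + s ^+ 2 - 2 * p * s * cos a)
    + t * (q ^+ 2 + s ^+ 2 - 2 * q * s * cos b)
    - t * (1 - t) * (p ^+ 2 + q ^+ 2 - 2 * p * q * c)); first by ring.
  by rewrite ha hb; ring.
have tt0 : 0 <= t * (1 - t) by rewrite mulr_ge0// subr_ge0.
have le0 : t * (1 - t) * (D ^+ 2 - E) <= 0.
  by rewrite mulr_ge0_le0// subr_le0.
have u0 := sqr_ge0 u; have v0 := sqr_ge0 v.
have /eqP : u ^+ 2 = 0 by lra.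
rewrite sqrf_eq0 => /eqP uz.
have : (1 - t) * (p ^+ 2 + s ^+ 2 - 2 * p * s * cos a)
     + t * (q ^+ 2 + s ^+ 2 - 2 * q * s * cos b)
     = (1 - t) * p ^+ 2 + t * q ^+ 2 - s ^+ 2 - 2 * s * u by rewrite /u; ring.
by rewrite ha hb uz; lra.
Qed.

(** If the truncated angles at [z] add up to at most pi, the two cone triangles unfold side by side
    in the plane, where the triangle inequality in [X] keeps the outer points at distance at least
    [D]. Otherwise [z] is the apex. *)
Lemma cone_radius_between (z0 z1 z : cone X) (t : R) : 0 <= t <= 1 ->
  mdist z0 z = t * mdist z0 z1 -> mdist z z1 = (1 - t) * mdist z0 z1 ->
  cone_radius z ^+ 2 = (1 - t) * cone_radius z0 ^+ 2
    + t * cone_radius z1 ^+ 2 - t * (1 - t) * mdist z0 z1 ^+ 2.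
Proof.
elim/cone_ind: z0 => x p; elim/cone_ind: z1 => y q; elim/cone_ind: z => w s.
set D := mdist (cone_point x p) (cone_point y q).
rewrite !cone_radiusE => t01 d0 d1.
have := sqr_mdist_cone x w p s; have := sqr_mdist_cone w y s q.
have := sqr_mdist_cone x y p q; rewrite -/D d0 d1.
set a := Num.min pi (mdist x w); set b := Num.min pi (mdist w y).
set c := Num.min pi (mdist x y) => hD hb ha.
have /andP[a0 api] : 0 <= a <= pi := min_pi_mdist_itv x w.
have /andP[b0 bpi] : 0 <= b <= pi := min_pi_mdist_itv w y.
have /andP[c0 cpi] : 0 <= c <= pi := min_pi_mdist_itv x y.
have [ab|ab] := leP (a + b) pi.
  have cab : c <= a + b.
    rewrite /a /b /c; have := metric_triangle x w y.
    have := mdist_ge0 x w; have := mdist_ge0 w y; have := pi_ge0 R.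
    by rewrite !minEle; do !case: ifP => /=; lra.
  have cosab : cos (a + b) <= cos c.
    by rewrite leNgt ltr_cos ?in_itv/= ?c0 ?cpi ?addr_ge0//= -leNgt.
  apply: (planar_radius _ _ _ _ _ a b t01).
  - by rewrite -ha exprMn.
  - by rewrite -exprMn hb; ring.
  - by rewrite hD lerD2l lerN2 ler_wpM2l// !mulr_ge0.
(* A geodesic making an angle larger than pi at z would be shortened by
   passing through the apex, so z is the apex. *)
have cosb : cos b < - cos a.
  have -> : - cos a = cos (- a + pi) by rewrite cosDpi cosN.
  rewrite ltr_cos ?in_itv/= ?b0 ?bpi//; first by lra.
  by apply/andP; split; lra.
have Da : p%:num - s%:num * cos a <= t * D.
  rewrite -d0 cone_mdistE; apply: le_cone_radicand_sqrt.
    exact: cos_le1.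
  exact: cos_geN1.
have Db : q%:num - s%:num * cos b <= (1 - t) * D.
  rewrite -d1 metric_sym cone_mdistE metric_sym; apply: le_cone_radicand_sqrt.
    exact: cos_le1.
  exact: cos_geN1.
have D0 : 0 <= D by exact: mdist_ge0.
have Dpq : D <= p%:num + q%:num.
  rewrite -ler_sqr ?nnegrE ?addr_ge0// hD.
  have : 0 <= 2 * p%:num * q%:num * (1 + cos c).
    by rewrite !mulr_ge0// -lerBlDl sub0r cos_geN1.
  lra.
(* Adding [Da], [Db] and [Dpq] gives [s (- cos a - cos b) <= 0], while [cosb] makes the second
   factor positive. *)
have s0 : s%:num = 0.
  apply/eqP; rewrite eq_le -[_ <= _]negbK -ltNge; apply/andP; split=> //.
  apply/negP => s0.
  have : 0 < s%:num * (- cos a - cos b) by rewrite mulr_gt0// subr_gt0.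
  lra.
move: Da Db; rewrite s0 !mul0r !subr0 => Da Db.
(* Now [p <= t D] and [q <= (1 - t) D], and [D <= p + q] forces equality in both. *)
have -> : p%:num = t * D by lra.
have -> : q%:num = (1 - t) * D by lra.
by ring.
Qed.

Lemma Geod_cone_radius (z0 z1 : cone X) (z : {i01 R} -> cone X) :
  Geod z0 z1 z -> forall t : {i01 R},
  cone_radius (z t) ^+ 2 = (1 - t%:num) * cone_radius z0 ^+ 2
    + t%:num * cone_radius z1 ^+ 2
    - t%:num * (1 - t%:num) * mdist z0 z1 ^+ 2.
Proof.
move=> [zE0 zE1 zd] t; apply: cone_radius_between.
- by apply/andP; split.
- by rewrite -{1}zE0 zd subr0 ger0_norm.
- by rewrite -{1}zE1 zd /= ger0_norm// subr_ge0.
Qed.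

End cone.

Section reparametrization.
Context {R : realType}.
Variables (r0 r1 : {nonneg R}) (t : {i01 R}).

(* Valid also where [A01] vanishes, since [r1 * t] vanishes there too. *)
Lemma A01_mul_B01 :
  (A01 r0 r1 t)%:num * (B01 r0 r1 t)%:num = r1%:num * t%:num.
Proof.
rewrite [(B01 _ _ _)%:num]/=.
have [A0|A0] := eqVneq (A01 r0 r1 t)%:num 0; last by rewrite mulrC divfK.
(* [A01] is the sum of these two nonnegative terms, so both vanish with it. *)
have h0 : 0 <= (1 - t%:num) * r0%:num by rewrite mulr_ge0// subr_ge0.
have h1 : 0 <= r1%:num * t%:num by rewrite mulr_ge0.
by move: A0; rewrite [X in X = 0]/= => A0; rewrite /= A0 mul0r; lra.
Qed.

(** Together with [A01_mul_B01], this eliminates the division in [B01]. *)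
Lemma A01_mul_onemB01 : (A01 r0 r1 t)%:num * (1 - (B01 r0 r1 t)%:num) =
  r0%:num * (1 - t%:num).
Proof. by rewrite mulrBr mulr1 A01_mul_B01 /=; ring. Qed.

End reparametrization.

Theorem proposition2p8 (R : realType) (X : metricType R)
    (hX : geodesic_space X) (x0 x1 : X) (r0 r1 : {nonneg R})
    (rt0 rt1 : {nonneg R}) (z01 : {i01 R} -> cone X)
    (hz : Geod (cone_point x0 r0) (cone_point x1 r1) z01) :
  Geod (cone_scale rt0 (cone_point x0 r0)) (cone_scale rt1 (cone_point x1 r1))
    (fun t : {i01 R} => cone_scale (A01 rt0 rt1 t) (z01 (B01 rt0 rt1 t))).
Proof.
have radE := Geod_cone_radius _ _ _ hz.
case: (hz) => zE0 zE1 zd; split.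
- have -> : B01 rt0 rt1 0%:i01 = 0%:i01.
    by apply/val_inj; rewrite /= mulr0 mul0r.
  have -> : A01 rt0 rt1 0%:i01 = rt0 by apply/val_inj; rewrite /= mulr0 addr0.
  by rewrite zE0.
- have A1 : A01 rt0 rt1 1%:i01 = rt1 by apply/val_inj => /=; ring.
  (* If [rt1] is 0, [B01] at 1 takes the default value 0 instead of 1, but both scaled points are
     the apex. *)
  rewrite A1; have [rt10|rt10] := eqVneq rt1%:num 0.
    by rewrite !(cone_scale0 _ x0 rt10).
  have -> : B01 rt0 rt1 1%:i01 = 1%:i01.
    apply/val_inj; rewrite [LHS]/= mulr1.
    have -> : rt0%:num + (rt1%:num - rt0%:num) * 1 = rt1%:num by ring.
    by rewrite divff.
  by rewrite zE1.
- move=> s t; apply/eqP.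
  rewrite -(@eqrXn2 _ 2) ?mulr_ge0 ?mdist_ge0 ?normr_ge0//.
  rewrite exprMn real_normK ?num_real// !sqr_mdist_cone_scale zd exprMn.
  rewrite real_normK ?num_real// !radE.
  set D := mdist _ _ ^+ 2.
  set p := cone_radius _ ^+ 2; set q := cone_radius (cone_point x1 r1) ^+ 2.
  move: (A01_mul_B01 rt0 rt1 s) (A01_mul_onemB01 rt0 rt1 s).
  move: (A01_mul_B01 rt0 rt1 t) (A01_mul_onemB01 rt0 rt1 t).
  have : (A01 rt0 rt1 s)%:num - (A01 rt0 rt1 t)%:num
    = (rt1%:num - rt0%:num) * (s%:num - t%:num) by rewrite /=; ring.
  move: (A01 rt0 rt1 s)%:num (A01 rt0 rt1 t)%:num => a b.
  move: (B01 rt0 rt1 s)%:num (B01 rt0 rt1 t)%:num => u v hab ht ht' hs hs'.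
  (* Regrouped so that [a], [b], [u], [v] occur only through [a - b] and the four products known
     from the reparametrization. *)
  apply/eqP; transitivity
    ((b * (1 - v) - a * (1 - u)) * (a * u - b * v) * D
     + (a - b) * (a * (1 - u) * p + a * u * q - b * (1 - v) * p - b * v * q)).
    by ring.
  by rewrite hab ht ht' hs hs'; ring.
Qed.
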